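(* The map $\mathsf{K}\mapsto\mathbb{V}(\mathsf{K}^-)$ is a join-preserving (hence isotone) surjection from the lattice of subvarieties of the variety of De Morgan monoids onto the lattice of subvarieties of the variety of relevant algebras. Moreover, it remains surjective when its domain is restricted to the subvarieties of De Morgan monoids that contain $\mathbf{2}$, together with the trivial variety.
   Context: An involutive (commutative) residuated lattice (IRL) is an algebra $\langle A;\cdot,\wedge,\vee,\neg,e\rangle$ such that $\langle A;\cdot,e\rangle$ is a commutative monoid, $\langle A;\wedge,\vee\rangle$ is a lattice with order $\leqslant$, $\neg\neg x=x$, and $x\cdot y\leqslant z\iff \neg z\cdot y\leqslant\neg x$. A De Morgan monoid is an IRL with distributive lattice reduct satisfying $x\leqslant x\cdot x$. A relevant algebra is an algebra $\langle A;\cdot,\wedge,\vee,\neg\rangle$ such that $\langle A;\cdot\rangle$ is a commutative semigroup, $\langle A;\wedge,\vee\rangle$ is a distributive lattice, and for all $a,b,c$: $\neg\neg a=a\leqslant a\cdot a$; $a\leqslant b$ iff $\neg b\leqslant\neg a$; $a\cdot b\leqslant c$ iff $a\cdot\neg c\leqslant\neg b$; $a\leqslant a\cdot(\neg(b\cdot\neg b)\wedge\neg(c\cdot\neg c))$. Relevant algebras form a variety. For a De Morgan monoid $\mathbf{A}$, $\mathbf{A}^-=\langle A;\cdot,\wedge,\vee,\neg\rangle$ is its $e$-free reduct; for a class $\mathsf{K}$, $\mathsf{K}^-=\{\mathbf{A}^-:\mathbf{A}\in\mathsf{K}\}$, and $\mathbb{V}$ denotes generated variety. $\mathbf{2}$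 is the two-element Boolean algebra viewed as a De Morgan monoid on $\{\neg e<e\}$ with $\cdot=\wedge$. *)

(* Defs.v *)
From HB Require Import structures.
From mathcomp Require Import all_boot all_order.
From mathcomp Require Import boolp classical_sets.

Set Implicit Arguments.
Unset Strict Implicit.
Unset Printing Implicit Defensive.

Local Open Scope classical_set_scope.

Record signature := Signature {
  symbol : Type;
  arity : symbol -> nat }.

(* Algebras are nonempty, as usual; this matters for signatures without
   constants, such as that of relevant algebras. *)
Record algebra (S : signature) := Algebra {
  carrier :> Type;
  carrier_inhabited : inhabited carrier;
  op : forall f : symbol S, (arity f).-tuple carrier -> carrier }.

Definition is_hom S (A B : algebra S) (h : A -> B) : Prop :=
  forall (f : symbol S) (t : (arity f).-tuple A),
    h (op t) = op (map_tuple h t).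

Lemma prod_inhabited S (I : Type) (F : I -> algebra S) :
  inhabited (forall i, F i).
Proof.
by split=> i; exact: inhabited_witness (carrier_inhabited (F i)).
Qed.

Definition prod_algebra S (I : Type) (F : I -> algebra S) : algebra S :=
  Algebra (prod_inhabited F)
    (fun f (t : (arity f).-tuple (forall i, F i)) (i : I) =>
       op (map_tuple (fun x : forall i, F i => x i) t)).

Record is_variety S (K : set (algebra S)) : Prop := IsVariety {
  variety_H : forall (A B : algebra S) (h : A -> B),
    is_hom h -> (forall y, exists x, h x = y) -> K A -> K B;
  variety_S : forall (A B : algebra S) (h : A -> B),
    is_hom h -> injective h -> K B -> K A;
  variety_P : forall (I : Type) (F : I -> algebra S),
    (forall i, K (F i)) -> K (prod_algebra F) }.

Definition generated_variety S (K : set (algebra S)) : set (algebra S) :=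
  smallest (@is_variety S) K.

Lemma generated_is_variety S (K : set (algebra S)) :
  is_variety (generated_variety K).
Proof.
split.
- move=> A B h hh sh KA W [vW KW].
  by apply: (variety_H vW hh sh); apply: KA.
- move=> A B h hh ih KB W [vW KW].
  by apply: (variety_S vW hh ih); apply: KB.
- move=> I F KF W [vW KW].
  by apply: (variety_P vW) => i; apply: KF.
Qed.

Lemma setI_is_variety S (K L : set (algebra S)) :
  is_variety K -> is_variety L -> is_variety (K `&` L).
Proof.
move=> vK vL; split.
- move=> A B h hh sh [KA LA]; split.
    exact: (variety_H vK hh sh KA).
  exact: (variety_H vL hh sh LA).
- move=> A B h hh ih [KB LB]; split.
    exact: (variety_S vK hh ih KB).
  exact: (variety_S vL hh ih LB).
- move=> I F KF; split.
    by apply: (variety_P vK) => i; case: (KF i).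
  by apply: (variety_P vL) => i; case: (KF i).
Qed.

Definition trivial_class S : set (algebra S) :=
  [set A : algebra S | forall x y : A, x = y].

Lemma trivial_is_variety S : is_variety (@trivial_class S).
Proof.
split.
- move=> A B h _ sh tA x y.
  by case: (sh x) (sh y) => a <- [b <-]; rewrite (tA a b).
- by move=> A B h _ ih tB x y; apply: ih; apply: tB.
- by move=> I F tF x y; apply: functional_extensionality_dep => i; apply: tF.
Qed.

Lemma trivial_sub_variety S (V : set (algebra S)) :
  is_variety V -> @trivial_class S `<=` V.
Proof.
move=> vV A tA.
pose F (i : False) : algebra S := A.
pose h (_ : A) : prod_algebra F := fun i : False => match i with end.
apply: (@variety_S _ _ vV A (prod_algebra F) h).
- by move=> f t; apply: functional_extensionality_dep; case.
- by move=> x y _; apply: tA.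
- by apply: (variety_P vV); case.
Qed.

Record variety S := Variety {
  variety_class :> set (algebra S);
  variety_classP : is_variety variety_class }.

Record subvariety S (V : variety S) := Subvariety {
  subvariety_class :> set (algebra S);
  subvarietyP : is_variety subvariety_class;
  subvariety_sub : subvariety_class `<=` V }.

Fact subvariety_display : Order.disp_t. Proof. exact: Order.Disp tt tt. Qed.

Section SubvarietyLattice.
Variables (S : signature) (V : variety S).
Implicit Types K L M : subvariety V.

Lemma subvariety_inj K L :
  subvariety_class K = subvariety_class L -> K = L.
Proof.
case: K L => [K vK sK] [L vL sL] /= KL; subst L.
by rewrite (Prop_irrelevance vK vL) (Prop_irrelevance sK sL).
Qed.

HB.instance Definition _ := gen_eqMixin (subvariety V).
HB.instance Definition _ := gen_choiceMixin (subvariety V).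

Definition subvariety_le K L : bool :=
  `[< subvariety_class K `<=` subvariety_class L >].

Lemma subvariety_le_refl : reflexive subvariety_le.
Proof. by move=> K; apply/asboolP. Qed.

Lemma subvariety_le_anti : antisymmetric subvariety_le.
Proof.
move=> K L /andP[/asboolP KL /asboolP LK].
by apply: subvariety_inj; apply/seteqP.
Qed.

Lemma subvariety_le_trans : transitive subvariety_le.
Proof.
move=> K L M /asboolP LK /asboolP KM; apply/asboolP.
exact: subset_trans LK KM.
Qed.

HB.instance Definition _ := Order.Le_isPOrder.Build subvariety_display
  (subvariety V) subvariety_le_refl subvariety_le_anti subvariety_le_trans.

Definition subvariety_meet K L : subvariety V :=
  Subvariety (setI_is_variety (subvarietyP K) (subvarietyP L))
    (fun A KLA => @subvariety_sub _ _ K A (proj1 KLA)).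

Lemma generated_sub (C : set (algebra S)) :
  C `<=` V -> generated_variety C `<=` V.
Proof. exact: (smallest_sub (variety_classP V)). Qed.

Lemma subvarietyU_sub K L :
  subvariety_class K `|` subvariety_class L `<=` V.
Proof. by move=> A []; apply: subvariety_sub. Qed.

Definition subvariety_join K L : subvariety V :=
  Subvariety (generated_is_variety (subvariety_class K `|` subvariety_class L))
    (generated_sub (@subvarietyU_sub K L)).

Lemma subvariety_meetP K L M :
  subvariety_le K (subvariety_meet L M)
    = subvariety_le K L && subvariety_le K M.
Proof.
apply/asboolP/andP => [KLM|[/asboolP KL /asboolP KM] A KA].
  by split; apply/asboolP => A /KLM [].
by split; [apply: KL|apply: KM].
Qed.

Lemma subvariety_joinP K L M :
  subvariety_le (subvariety_join K L) M
    = subvariety_le K M && subvariety_le L M.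
Proof.
apply/asboolP/andP => [KLM|[/asboolP KM /asboolP LM]].
  by split; apply/asboolP => A ?; apply: KLM; apply: sub_gen_smallest;
    [left|right].
apply: smallest_sub; first exact: subvarietyP.
by move=> A [/KM|/LM].
Qed.

HB.instance Definition _ := Order.POrder_MeetJoin_isLattice.Build
  subvariety_display (subvariety V) subvariety_meetP subvariety_joinP.

Definition trivial_subvariety : subvariety V :=
  Subvariety (@trivial_is_variety S)
    (trivial_sub_variety (variety_classP V)).

End SubvarietyLattice.

Inductive ra_symbol := Mul | Meet | Join | Neg.

Definition ra_arity (f : ra_symbol) : nat := if f is Neg then 1 else 2.

Definition ra_signature := Signature ra_arity.

Inductive dm_symbol := Efree of ra_symbol | Unit.

Definition dm_arity (f : dm_symbol) : nat :=
  if f is Efree g then ra_arity g else 0.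

Definition dm_signature := Signature dm_arity.

Definition reduct (A : algebra dm_signature) : algebra ra_signature :=
  @Algebra ra_signature A (carrier_inhabited A)
    (fun f => @op dm_signature A (Efree f)).

Section Operations.
Variable A : algebra ra_signature.
Implicit Types x y : A.
Definition mul x y : A := @op ra_signature A Mul [tuple x; y].
Definition meet x y : A := @op ra_signature A Meet [tuple x; y].
Definition join x y : A := @op ra_signature A Join [tuple x; y].
Definition neg x : A := @op ra_signature A Neg [tuple x].
Definition leq_alg x y : Prop := meet x y = x.
End Operations.

Definition unit_alg (A : algebra dm_signature) : reduct A :=
  @op dm_signature A Unit [tuple].

Declare Scope alg_scope.
Delimit Scope alg_scope with A.
Notation "x * y" := (mul x y) : alg_scope.
Notation "x `&` y" := (meet x y) : alg_scope.
Notation "x `|` y" := (join x y) : alg_scope.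
Notation "~` x" := (neg x) : alg_scope.
Notation "x <= y" := (leq_alg x y) : alg_scope.
Local Open Scope alg_scope.

Record is_lattice (A : algebra ra_signature) : Prop := IsLattice {
  lat_meetC : commutative (@meet A);
  lat_joinC : commutative (@join A);
  lat_meetA : associative (@meet A);
  lat_joinA : associative (@join A);
  lat_meetUK : forall x y : A, x `&` (x `|` y) = x;
  lat_joinIK : forall x y : A, x `|` (x `&` y) = x }.

Definition is_distributive (A : algebra ra_signature) : Prop :=
  forall x y z : A, x `&` (y `|` z) = (x `&` y) `|` (x `&` z).

Record is_irl (A : algebra dm_signature) : Prop := IsIRL {
  irl_mulC : commutative (@mul (reduct A));
  irl_mulA : associative (@mul (reduct A));
  irl_mule : forall x : reduct A, x * unit_alg A = x;
  irl_lattice : is_lattice (reduct A);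
  irl_negK : forall x : reduct A, ~` ~` x = x;
  irl_residuation : forall x y z : reduct A,
    x * y <= z <-> ~` z * y <= ~` x }.

Record is_de_morgan_monoid (A : algebra dm_signature) : Prop := IsDMM {
  dmm_irl : is_irl A;
  dmm_distributive : is_distributive (reduct A);
  dmm_square : forall x : reduct A, x <= x * x }.

Record is_relevant_algebra (A : algebra ra_signature) : Prop := IsRA {
  ra_mulC : commutative (@mul A);
  ra_mulA : associative (@mul A);
  ra_lattice : is_lattice A;
  ra_distributive : is_distributive A;
  ra_negK : forall a : A, ~` ~` a = a;
  ra_square : forall a : A, a <= a * a;
  ra_contraposition : forall a b : A, a <= b <-> ~` b <= ~` a;
  ra_residuation : forall a b c : A, a * b <= c <-> a * ~` c <= ~` b;
  ra_identity : forall a b c : A,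
    a <= a * (~` (b * ~` b) `&` ~` (c * ~` c)) }.

Section Hom.
Variables (A B : algebra ra_signature) (h : A -> B).
Hypothesis hh : is_hom h.

Lemma hom_mul : {morph h : x y / x * y}.
Proof. by move=> x y; rewrite /mul hh; congr op; apply: val_inj. Qed.
Lemma hom_meet : {morph h : x y / x `&` y}.
Proof. by move=> x y; rewrite /meet hh; congr op; apply: val_inj. Qed.
Lemma hom_join : {morph h : x y / x `|` y}.
Proof. by move=> x y; rewrite /join hh; congr op; apply: val_inj. Qed.
Lemma hom_neg : {morph h : x / ~` x}.
Proof. by move=> x; rewrite /neg hh; congr op; apply: val_inj. Qed.
Definition homE := (hom_mul, hom_meet, hom_join, hom_neg).

Lemma hom_le x y : x <= y -> h x <= h y.
Proof. by rewrite /leq_alg -hom_meet => ->. Qed.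
End Hom.

Lemma hom_reduct (A B : algebra dm_signature) (h : A -> B) :
  is_hom h -> @is_hom ra_signature (reduct A) (reduct B) h.
Proof. by move=> hh f t; apply: (hh (Efree f)). Qed.

Lemma hom_unit (A B : algebra dm_signature) (h : A -> B) :
  is_hom h -> h (unit_alg A) = unit_alg B.
Proof.
by move=> hh; rewrite /unit_alg (hh Unit); congr op; apply: val_inj.
Qed.

Lemma proj_hom S (I : Type) (F : I -> algebra S) i :
  is_hom (fun x : prod_algebra F => x i).
Proof. by []. Qed.

Lemma lattice_le_join (A : algebra ra_signature) (x y : A) :
  is_lattice A -> x <= y -> x `|` y = y.
Proof. by move=> lA <-; rewrite (lat_joinC lA) (lat_meetC lA) (lat_joinIK lA). Qed.

(* Closure under subdirect products, which covers both S and P. *)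
Section Subdirect.
Variables (A : algebra ra_signature) (I : Type).
Variables (B : I -> algebra ra_signature) (h : forall i, A -> B i).
Hypothesis hh : forall i, is_hom (h i).
Hypothesis ih : forall x y, (forall i, h i x = h i y) -> x = y.

Let le_sub (x y : A) : (forall i, h i x <= h i y) -> x <= y.
Proof. by move=> hxy; apply: ih => i; rewrite (hom_meet (hh i)); apply: hxy. Qed.

Lemma subdirect_lattice : (forall i, is_lattice (B i)) -> is_lattice A.
Proof.
move=> lB; split=> [x y|x y|x y z|x y z|x y|x y]; apply: ih => i;
  rewrite !(homE (hh i)).
- exact: (lat_meetC (lB i)).
- exact: (lat_joinC (lB i)).
- exact: (lat_meetA (lB i)).
- exact: (lat_joinA (lB i)).
- exact: (lat_meetUK (lB i)).
- exact: (lat_joinIK (lB i)).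
Qed.

Lemma subdirect_distributive :
  (forall i, is_distributive (B i)) -> is_distributive A.
Proof. by move=> dB x y z; apply: ih => i; rewrite !(homE (hh i)) dB. Qed.

Lemma subdirect_relevant :
  (forall i, is_relevant_algebra (B i)) -> is_relevant_algebra A.
Proof.
move=> rB; split=> [x y|x y z|||x|x|a b|a b c|a b c].
- by apply: ih => i; rewrite !(homE (hh i)) (ra_mulC (rB i)).
- by apply: ih => i; rewrite !(homE (hh i)) (ra_mulA (rB i)).
- by apply: subdirect_lattice => i; apply: ra_lattice.
- by apply: subdirect_distributive => i; apply: ra_distributive.
- by apply: ih => i; rewrite !(homE (hh i)) (ra_negK (rB i)).
- by apply: le_sub => i; rewrite !(homE (hh i)); apply: ra_square.
- split=> /(hom_le (hh _)) ab; apply: le_sub => i;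
    move: (ab i); rewrite !(homE (hh i));
    case: (ra_contraposition (rB i) (h i a) (h i b)) => P Q;
    by [exact: P | exact: Q].
- split=> /(hom_le (hh _)) ab; apply: le_sub => i;
    move: (ab i); rewrite !(homE (hh i));
    case: (ra_residuation (rB i) (h i a) (h i b) (h i c)) => P Q;
    by [exact: P | exact: Q].
- by apply: le_sub => i; rewrite !(homE (hh i)); apply: ra_identity.
Qed.
End Subdirect.

Lemma subdirect_dmm (A : algebra dm_signature) (I : Type)
    (B : I -> algebra dm_signature) (h : forall i, A -> B i) :
  (forall i, is_hom (h i)) ->
  (forall x y, (forall i, h i x = h i y) -> x = y) ->
  (forall i, is_de_morgan_monoid (B i)) -> is_de_morgan_monoid A.
Proof.
move=> hh ih dB; pose hr i := hom_reduct (hh i).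
pose iB i := dmm_irl (dB i).
have le_sub (x y : reduct A) :
    (forall i, (h i x : reduct (B i)) <= h i y) -> x <= y.
  by move=> hxy; apply: ih => i; rewrite (hom_meet (hr i)); apply: hxy.
split; first split=> [x y|x y z|x||x|x y z].
- by apply: ih => i; rewrite !(homE (hr i)) (irl_mulC (iB i)).
- by apply: ih => i; rewrite !(homE (hr i)) (irl_mulA (iB i)).
- by apply: ih => i; rewrite (hom_mul (hr i)) (hom_unit (hh i)) (irl_mule (iB i)).
- by apply: (subdirect_lattice hr ih) => i; apply: irl_lattice.
- by apply: ih => i; rewrite !(homE (hr i)) (irl_negK (iB i)).
- split=> /(hom_le (hr _)) ab; apply: le_sub => i;
    move: (ab i); rewrite !(homE (hr i));
    case: (irl_residuation (iB i) (h i x) (h i y) (h i z)) => P Q;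
    by [exact: P | exact: Q].
- by apply: (subdirect_distributive hr ih) => i; apply: dmm_distributive.
- by move=> x; apply: le_sub => i; rewrite !(homE (hr i)); apply: dmm_square.
Qed.

Section Image.
Variables (A B : algebra ra_signature) (h : A -> B).
Hypothesis hh : is_hom h.
Hypothesis sh : forall y, exists x, h x = y.

Lemma image_lattice : is_lattice A -> is_lattice B.
Proof.
move=> lA; split=> [x y|x y|x y z|x y z|x y|x y];
  case: (sh x) (sh y) => a <- [b <-]; try (case: (sh z) => c <-);
  rewrite -!(homE hh).
- by rewrite (lat_meetC lA).
- by rewrite (lat_joinC lA).
- by rewrite (lat_meetA lA).
- by rewrite (lat_joinA lA).
- by rewrite (lat_meetUK lA).
- by rewrite (lat_joinIK lA).
Qed.

Lemma image_distributive : is_distributive A -> is_distributive B.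
Proof.
move=> dA x y z; case: (sh x) (sh y) (sh z) => a <- [b <-] [c <-].
by rewrite -!(homE hh) dA.
Qed.

Lemma image_le x z : is_lattice A -> h x <= h z ->
  exists2 z', h z' = h z & x <= z'.
Proof.
move=> lA xz; exists (x `|` z); last exact: (lat_meetUK lA).
by rewrite (hom_join hh) (lattice_le_join (image_lattice lA) xz).
Qed.

Lemma image_relevant : is_relevant_algebra A -> is_relevant_algebra B.
Proof.
move=> rA; have lA := ra_lattice rA.
have nK (x : B) : ~` ~` x = x.
  by case: (sh x) => a <-; rewrite -!(homE hh) (ra_negK rA).
have contra (x y : B) : x <= y -> ~` y <= ~` x.
  case: (sh x) (sh y) => a <- [b <-] /(image_le lA)[b' <-].
  by move=> /(ra_contraposition rA) /(hom_le hh); rewrite !(homE hh).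
have res (x y z : B) : x * y <= z -> x * ~` z <= ~` y.
  case: (sh x) (sh y) (sh z) => a <- [b <-] [c <-].
  rewrite -(hom_mul hh) => /(image_le lA)[c' <-].
  by move=> /(ra_residuation rA) /(hom_le hh); rewrite !(homE hh).
split=> [x y|x y z|||x|x|x y|x y z|x y z].
- by case: (sh x) (sh y) => a <- [b <-]; rewrite -!(homE hh) (ra_mulC rA).
- case: (sh x) (sh y) (sh z) => a <- [b <-] [c <-].
  by rewrite -!(homE hh) (ra_mulA rA).
- exact: image_lattice.
- by apply: image_distributive; apply: ra_distributive.
- exact: nK.
- by case: (sh x) => a <-; rewrite -(hom_mul hh); apply/hom_le/ra_square.
- by split=> [|/contra]; [apply: contra|rewrite !nK].
- by split=> [|/res]; [apply: res|rewrite !nK].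
- case: (sh x) (sh y) (sh z) => a <- [b <-] [c <-].
  by rewrite -!(homE hh); apply/hom_le/ra_identity.
Qed.
End Image.

Lemma image_dmm (A B : algebra dm_signature) (h : A -> B) :
  is_hom h -> (forall y, exists x, h x = y) ->
  is_de_morgan_monoid A -> is_de_morgan_monoid B.
Proof.
move=> hh sh dA; have hr := hom_reduct hh.
have iA := dmm_irl dA; have lA := irl_lattice iA.
have nK (x : reduct B) : ~` ~` x = x.
  by case: (sh x) => a <-; rewrite -!(homE hr) (irl_negK iA).
have res (x y z : reduct B) : x * y <= z -> ~` z * y <= ~` x.
  case: (sh x) (sh y) (sh z) => a <- [b <-] [c <-].
  rewrite -(hom_mul hr) => /(image_le hr sh lA)[c' <-].
  by move=> /(irl_residuation iA) /(hom_le hr); rewrite !(homE hr).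
split; first split=> [x y|x y z|x||x|x y z].
- by case: (sh x) (sh y) => a <- [b <-]; rewrite -!(homE hr) (irl_mulC iA).
- case: (sh x) (sh y) (sh z) => a <- [b <-] [c <-].
  by rewrite -!(homE hr) (irl_mulA iA).
- by case: (sh x) => a <-; rewrite -(hom_unit hh) -(hom_mul hr) (irl_mule iA).
- exact: (image_lattice hr sh lA).
- exact: nK.
- by split=> [|/res]; [apply: res|rewrite !nK].
- exact: (image_distributive hr sh (dmm_distributive dA)).
- move=> x; case: (sh x) => a <-; rewrite -(hom_mul hr).
  by apply/(hom_le hr)/dmm_square.
Qed.

Lemma dmm_is_variety : is_variety is_de_morgan_monoid.
Proof.
split.
- by move=> A B h; apply: image_dmm.
- move=> A B h hh ih dB.
  by apply: (@subdirect_dmm A unit (fun=> B) (fun=> h)) => // x y /(_ tt)/ih.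
- move=> I F dF; apply: (subdirect_dmm (@proj_hom _ I F)) => // x y.
  exact: functional_extensionality_dep.
Qed.

Lemma relevant_is_variety : is_variety is_relevant_algebra.
Proof.
split.
- by move=> A B h; apply: image_relevant.
- move=> A B h hh ih rB.
  by apply: (@subdirect_relevant A unit (fun=> B) (fun=> h)) => // x y /(_ tt)/ih.
- move=> I F rF; apply: (subdirect_relevant (@proj_hom _ I F)) => // x y.
  exact: functional_extensionality_dep.
Qed.

Definition DMM : variety dm_signature := Variety dmm_is_variety.
Definition RA : variety ra_signature := Variety relevant_is_variety.

Lemma reduct_relevant (A : algebra dm_signature) :
  is_de_morgan_monoid A -> is_relevant_algebra (reduct A).
Proof.
move=> dA; have iA := dmm_irl dA; have lA := irl_lattice iA.
have mulC := irl_mulC iA; have nK := irl_negK iA; have mule := irl_mule iA.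
have res := irl_residuation iA.
have contra (x y : reduct A) : x <= y <-> ~` y <= ~` x.
  by have := res x (unit_alg A) y; rewrite !mule.
have le_refl (x : reduct A) : x <= x.
  by rewrite /leq_alg -{2}(lat_joinIK lA x x) (lat_meetUK lA).
have le_trans (x y z : reduct A) : x <= y -> y <= z -> x <= z.
  by rewrite /leq_alg => <- <-; rewrite -!(lat_meetA lA) (le_refl z).
have mono (x y z : reduct A) : x <= y -> z * x <= z * y.
  move=> /contra xy; rewrite (mulC z x); apply: (proj2 (res _ _ _)).
  by apply: le_trans xy; apply: (proj1 (res _ _ _)); rewrite mulC.
have e_le (b : reduct A) : unit_alg A <= ~` (b * ~` b).
  rewrite -(nK (unit_alg A)); apply: (proj1 (contra _ _)).
  rewrite mulC; apply: (proj1 (res _ _ _)).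
  by rewrite mulC mule; apply: le_refl.
split.
- exact: mulC.
- exact: irl_mulA.
- exact: lA.
- exact: dmm_distributive.
- exact: nK.
- exact: dmm_square.
- exact: contra.
- by move=> a b c; rewrite (mulC a b) (mulC a (~` c)).
- move=> a b c; rewrite -{1}(mule a); apply: mono.
  by rewrite /leq_alg (lat_meetA lA) (e_le b) (e_le c).
Qed.

Definition reduct_class (K : set (algebra dm_signature)) :
    set (algebra ra_signature) := reduct @` K.

Lemma reduct_class_sub (K : subvariety DMM) : reduct_class K `<=` RA.
Proof. by move=> _ [A KA <-]; apply: reduct_relevant; apply: subvariety_sub KA. Qed.

Definition reduct_variety (K : subvariety DMM) : subvariety RA :=
  Subvariety (generated_is_variety (reduct_class K))
    (generated_sub (@reduct_class_sub K)).

(* The unit is [true], so its negation is [false] and lies below it. *)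
Definition two : algebra dm_signature :=
  @Algebra dm_signature bool (inhabits true) (fun f : dm_symbol =>
    match f return (dm_arity f).-tuple bool -> bool with
    | Efree Mul | Efree Meet => fun t => tnth t ord0 && tnth t ord_max
    | Efree Join => fun t => tnth t ord0 || tnth t ord_max
    | Efree Neg => fun t => ~~ tnth t ord0
    | Unit => fun=> true
    end).

Lemma two_dmm : is_de_morgan_monoid two.
Proof.
split; first split.
all: try by repeat case.
all: try by do 3!case; split.
split; repeat case; try done.
Qed.

(* Main.v *)
(** Say that [w] preserves [a] when [w * a <= a].  The elements of a relevant
    algebra preserved by [|d| = ~(d * ~d)] form a subalgebra in which [|d|] is
    an identity, hence the reduct of a De Morgan monoid.  These subalgebras are
    directed, because those of [d] and [d'] lie in that of [|d| & |d'|], and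
    they cover the algebra.  As a variety contains every directed union of
    subalgebras that it contains, a variety [L] of relevant algebras is
    generated by the reducts of De Morgan monoids that belong to [L].

    A nontrivial [L] contains the reduct of the two-element algebra: in a De
    Morgan monoid with [x <> e], put [c = e | x | ~(e & x)] and [b = c * c];
    then [b * b = b], and [{~b, b}] is a two-element Boolean subreduct. *)
Require Import Defs.
From mathcomp Require Import all_boot all_order boolp classical_sets.

Set Implicit Arguments.
Unset Strict Implicit.
Unset Printing Implicit Defensive.

Import Order.LTheory.

Local Open Scope classical_set_scope.

(** * Subalgebras and directed unions *)

Section Subalgebra.
Variables (S : signature) (A : algebra S).

Definition subuniverse (U : set A) : Prop :=
  (exists a, U a) /\
  forall (f : symbol S) (t : (arity f).-tuple A),
    (forall i, U (tnth t i)) -> U (op t).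

Variables (U : set A) (subU : subuniverse U).

Lemma subuniverse_inhabited : inhabited {a | U a}.
Proof. by case: subU => -[a Ua] _; split; exists a. Qed.

Lemma subuniverse_op (f : symbol S) (t : (arity f).-tuple {a | U a}) :
  U (op (map_tuple sval t)).
Proof.
by case: subU => _; apply=> i; rewrite tnth_map; apply: svalP.
Qed.

Definition subalgebra : algebra S :=
  Algebra subuniverse_inhabited (fun f t => exist U _ (@subuniverse_op f t)).

Lemma sval_hom : @is_hom S subalgebra A sval.
Proof. by []. Qed.

Lemma sval_inj : injective (sval : subalgebra -> A).
Proof. by move=> [x Ux] [y Uy] /= xy; apply: eq_exist. Qed.

End Subalgebra.

Section DirectedUnion.
Variables (S : signature) (V : set (algebra S)) (vV : is_variety V).
Variables (A : algebra S) (I : Type) (U : I -> set A).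
Hypothesis subU : forall i, subuniverse (U i).
Hypothesis directedU :
  forall i j, exists k, U i `<=` U k /\ U j `<=` U k.
Hypothesis coverU : forall a, exists i, U i a.
Hypothesis VU : forall i, V (subalgebra (subU i)).

Lemma directed_bound n (g : 'I_n -> I) :
  exists k, forall m, U (g m) `<=` U k.
Proof.
elim: n g => [|n IHn] g.
  (* With nothing to bound, any index serves; covering some element supplies one. *)
  by case: (carrier_inhabited A) => a; case: (coverU a) => i _; exists i; case.
have [k gk] := IHn (g \o lift ord0).
have [l [kl gl]] := directedU k (g ord0).
exists l => m; case: (unliftP ord0 m) => [m' ->|-> //].
exact: subset_trans (gk m') kl.
Qed.

Let F (o : option I) : algebra S :=
  if o is Some i then subalgebra (subU i) else A.

(* The component at [None] is the limit of the others along [U]. *)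
Let eventually : set (prod_algebra F) :=
  [set p : prod_algebra F | exists i, forall j, U i `<=` U j ->
    sval (p (Some j) : subalgebra (subU j)) = p None].

Let eventually_section a : exists2 p, eventually p & p None = a.
Proof.
(* The arbitrary value used where [U i] misses [a] is harmless: once some [U i] contains [a], so
   does every larger [U j]. *)
pose p (o : option I) : F o :=
  match o with
  | None => a
  | Some i => match pselect (U i a) with
              | left Ua => exist _ a Ua
              | right _ => inhabited_witness (subuniverse_inhabited (subU i))
              end
  end.
exists p => //; have [i Ua] := coverU a.
by exists i => j ij; rewrite /p; case: pselect => // nUa; case: nUa; exact: ij.
Qed.

Let eventually_sub : subuniverse eventually.
Proof.
split.
  case: (carrier_inhabited A) => a.
  by have [p ? _] := eventually_section a; exists p.
(* Arities are finite, so a single [k] lies beyond the thresholds [g] of all arguments. *)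
move=> f t /choice[g gt]; have [k gk] := directed_bound g.
exists k => j kj; congr op; apply: eq_from_tnth => m; rewrite !tnth_map.
by apply: gt; apply: subset_trans (gk m) kj.
Qed.

(** The limit at [None] maps [Q] onto [A], while forgetting that component embeds [Q] in the product
    of the subalgebras. *)
Lemma directed_union_variety : V A.
Proof.
pose Q := subalgebra eventually_sub.
apply: (@variety_H _ _ vV Q A (fun q => sval q None)).
- by move=> f t; congr op; apply: eq_from_tnth => m; rewrite !tnth_map.
- by move=> a; have [p ep pa] := eventually_section a; exists (exist _ p ep).
pose P := prod_algebra (fun i => subalgebra (subU i)).
apply: (@variety_S _ _ vV Q P (fun q i => sval q (Some i))).
- move=> f t; apply: functional_extensionality_dep => i.
  by congr op; apply: eq_from_tnth => m; rewrite !tnth_map.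
- move=> [p ep] [q eq] /= pq; apply: eq_exist.
  have pqS i : p (Some i) = q (Some i) := congr1 (fun r => r i) pq.
  apply: functional_extensionality_dep => -[i|]; first exact: pqS.
  (* Both limits can be read at a common later index, where the components agree. *)
  have [[i pi] [j qj]] := (ep, eq).
  have [k [ik jk]] := directedU i j.
  by rewrite -(pi k ik) -(qj k jk) pqS.
exact: (variety_P vV).
Qed.

End DirectedUnion.

Local Open Scope alg_scope.

Lemma tuple1_eta T (t : 1.-tuple T) : t = [tuple tnth t ord0].
Proof. by apply: eq_from_tnth => i; rewrite !ord1. Qed.

Lemma tuple2_eta T (t : 2.-tuple T) : t = [tuple tnth t ord0; tnth t ord_max].
Proof.
apply: eq_from_tnth => i; case: (unliftP ord0 i) => [j|] -> //.
by rewrite ord1; have -> : lift ord0 (ord0 : 'I_1) = ord_max by apply: val_inj.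
Qed.

(** * Residuation and local units in relevant algebras *)

Section RelevantTheory.
Variables (A : algebra ra_signature) (rA : is_relevant_algebra A).
Implicit Types a b c x y z : A.

Let lA := ra_lattice rA.

Lemma ra_le_refl x : x <= x.
Proof. by rewrite /leq_alg -{2}(lat_joinIK lA x x) (lat_meetUK lA). Qed.

Lemma ra_le_trans y x z : x <= y -> y <= z -> x <= z.
Proof.
rewrite /leq_alg => <- yz.
by rewrite -(lat_meetA lA) yz.
Qed.

Lemma ra_le_anti x y : x <= y -> y <= x -> x = y.
Proof. by rewrite /leq_alg => xy yx; rewrite -xy (lat_meetC lA) yx. Qed.

Lemma ra_meet_lel x y : x `&` y <= x.
Proof. by rewrite /leq_alg (lat_meetC lA) (lat_meetA lA) ra_le_refl. Qed.

Lemma ra_meet_ler x y : x `&` y <= y.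
Proof. by rewrite (lat_meetC lA); apply: ra_meet_lel. Qed.

Lemma ra_le_meet z x y : z <= x -> z <= y -> z <= x `&` y.
Proof. by rewrite /leq_alg (lat_meetA lA) => ->. Qed.

Lemma ra_le_joinl x y : x <= x `|` y.
Proof. exact: (lat_meetUK lA). Qed.

Lemma ra_le_joinr x y : y <= x `|` y.
Proof. by rewrite (lat_joinC lA); apply: ra_le_joinl. Qed.

Lemma ra_join_le x y z : x <= z -> y <= z -> x `|` y <= z.
Proof.
move=> /(lattice_le_join lA) xz /(lattice_le_join lA) yz.
by rewrite /leq_alg -[in RHS](lat_meetUK lA (x `|` y) z) -(lat_joinA lA) yz xz.
Qed.

Lemma ra_le_neg x y : x <= y -> ~` y <= ~` x.
Proof. by case: (ra_contraposition rA x y). Qed.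

Lemma ra_le_impl a b c : a * b <= c <-> a <= ~` (b * ~` c).
Proof.
rewrite (ra_mulC rA a b); split.
  by move=> /(ra_residuation rA) /ra_le_neg; rewrite (ra_negK rA).
move=> /ra_le_neg; rewrite (ra_negK rA) => /(ra_residuation rA).
by rewrite !(ra_negK rA).
Qed.

Lemma ra_mul_mono a b x y : a <= b -> x <= y -> a * x <= b * y.
Proof.
have monol u v z : u <= v -> u * z <= v * z.
  move=> uv; apply/ra_le_impl; apply: ra_le_trans uv _.
  exact/ra_le_impl/ra_le_refl.
move=> ab xy; apply: ra_le_trans (monol _ _ x ab) _.
by rewrite !(ra_mulC rA b); apply: monol.
Qed.

Definition preserved (w : A) : set A := [set a | w * a <= a].

(** Products follow by associativity, meets by monotonicity, joins and negations by residuation.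
    With no constant in the signature, nonemptiness has to be assumed. *)
Lemma preserved_sub w : (exists a, preserved w a) -> subuniverse (preserved w).
Proof.
move=> nw; split=> // -[] t Ut; rewrite /preserved /=.
- rewrite (tuple2_eta t) -/(mul _ _) (ra_mulA rA).
  exact: ra_mul_mono (Ut _) (ra_le_refl _).
- rewrite (tuple2_eta t) -/(meet _ _).
  apply: ra_le_meet; apply: ra_le_trans (Ut _);
    apply: ra_mul_mono (ra_le_refl _) _;
    [exact: ra_meet_lel|exact: ra_meet_ler].
- rewrite (tuple2_eta t) -/(join _ _).
  rewrite (ra_mulC rA); apply/ra_le_impl; apply: ra_join_le; apply/ra_le_impl;
    rewrite (ra_mulC rA); apply: ra_le_trans (Ut _) _;
    [exact: ra_le_joinl|exact: ra_le_joinr].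
- rewrite (tuple1_eta t) -/(neg _).
  exact: (proj1 (ra_residuation rA _ _ _) (Ut _)).
Qed.

(** The residual of [d] by itself: the largest [w] with [w * d <= d]. *)
Definition local_unit d : A := ~` (d * ~` d).

Lemma preserved_local_unit d : preserved (local_unit d) d.
Proof. exact/ra_le_impl/ra_le_refl. Qed.

(** Preservation is one inequality; the other is [ra_identity] at [b = c = d]. *)
Lemma mul_local_unit d a : preserved (local_unit d) a -> a * local_unit d = a.
Proof.
move=> da; apply: ra_le_anti; first by rewrite (ra_mulC rA).
by have := ra_identity rA a d d; rewrite ra_le_refl.
Qed.

Lemma local_unit_sub d : subuniverse (preserved (local_unit d)).
Proof. by apply: preserved_sub; exists d; apply: preserved_local_unit. Qed.

(** The square of the local unit still preserves [d], so it lies below the largest such element. *)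
Lemma local_unit_preserved d : preserved (local_unit d) (local_unit d).
Proof.
have dP := preserved_local_unit d.
apply: (proj1 (ra_le_impl _ _ _)); rewrite -(ra_mulA rA).
apply: ra_le_trans (dP).
exact: ra_mul_mono (ra_le_refl _) dP.
Qed.

(** For the meet [u] of both local units, [ra_identity] gives [a <= u * a], whence
    [|u| * a <= |u| * u * a <= u * a]. This is below [a] as soon as one of the two units preserves
    [a]. *)
Lemma preserved_directed d d' : exists u,
  preserved (local_unit d) `<=` preserved (local_unit u) /\
  preserved (local_unit d') `<=` preserved (local_unit u).
Proof.
pose u := local_unit d `&` local_unit d'.
have uP a : u * a <= a -> preserved (local_unit u) a.
  move=> ua; apply: ra_le_trans ua.
  apply: (@ra_le_trans (local_unit u * (u * a))).
    apply: ra_mul_mono (ra_le_refl _) _; rewrite (ra_mulC rA).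
    exact: (ra_identity rA).
  rewrite (ra_mulA rA); apply: ra_mul_mono (ra_le_refl _).
  exact: preserved_local_unit.
exists u; split=> a da; apply: uP; apply: ra_le_trans da;
  apply: ra_mul_mono (ra_le_refl _); [exact: ra_meet_lel|exact: ra_meet_ler].
Qed.

End RelevantTheory.

(** * De Morgan monoids inside a relevant algebra *)

Lemma relevant_dmm (A : algebra dm_signature) :
  is_relevant_algebra (reduct A) ->
  (forall x : reduct A, x * unit_alg A = x) -> is_de_morgan_monoid A.
Proof.
move=> rA mul1; split; last exact: ra_square; last exact: ra_distributive.
split=> //; [exact: ra_mulC|exact: ra_mulA|exact: ra_lattice|exact: ra_negK|].
by move=> x y z; rewrite (ra_mulC rA x) (ra_mulC rA _ y); apply: ra_residuation.
Qed.

Section LocalMonoid.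
Variables (A : algebra ra_signature) (rA : is_relevant_algebra A) (d : A).

Definition local_algebra : algebra ra_signature :=
  subalgebra (local_unit_sub rA d).

Definition local_monoid : algebra dm_signature :=
  @Algebra dm_signature local_algebra (carrier_inhabited local_algebra)
    (fun f : dm_symbol =>
       match f return (dm_arity f).-tuple local_algebra -> local_algebra with
       | Efree g => @op ra_signature local_algebra g
       | Unit => fun=> exist _ _ (local_unit_preserved rA d)
       end).

Lemma local_algebra_variety (V : set (algebra ra_signature)) :
  is_variety V -> V A -> V local_algebra.
Proof.
by move=> vV; apply: (variety_S vV (@sval_hom _ _ _ _)); apply: sval_inj.
Qed.

Lemma local_monoid_dmm : is_de_morgan_monoid local_monoid.
Proof.
apply: relevant_dmm; first exact: local_algebra_variety relevant_is_variety rA.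
move=> [x dx]; apply: sval_inj.
rewrite [LHS](hom_mul (@sval_hom _ _ _ (local_unit_sub rA d))).
exact: mul_local_unit.
Qed.

End LocalMonoid.

(** * The two-element Boolean subreduct *)

Section TwoSubreduct.
Variables (A : algebra dm_signature) (dA : is_de_morgan_monoid A).
Let rA := reduct_relevant dA.

(** With [n = ~(c * c)], residuation gives [c * n <= ~c <= e], so [c * n <= c * n * n <= n].
    Residuating back, [c * (c * c) <= c * c]; multiplying by [c] once more bounds the fourth
    power. *)
Lemma mul_square (c : reduct A) :
  unit_alg A <= c -> ~` c <= unit_alg A -> c * c * (c * c) = c * c.
Proof.
move=> ec nce; have iA := dmm_irl dA.
pose n := ~` (c * c).
have cn : c * n <= ~` c :=
  proj1 (ra_residuation rA c c (c * c)) (ra_le_refl rA _).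
have cnn : c * n <= n.
  apply: (@ra_le_trans _ rA (c * (n * n))).
    exact: ra_mul_mono (ra_le_refl rA _) (ra_square rA _).
  rewrite (ra_mulA rA) -[X in _ <= X](irl_mule iA) [X in _ <= X](ra_mulC rA).
  apply: ra_mul_mono (ra_le_refl rA _) => //.
  exact: ra_le_trans nce.
have cube : c * (c * c) <= c * c := proj2 (ra_residuation rA _ _ _) cnn.
apply: (ra_le_anti rA); last exact: ra_square.
rewrite -(ra_mulA rA); apply: (ra_le_trans rA) (cube).
exact: ra_mul_mono (ra_le_refl rA _) cube.
Qed.

(** Residuating [b * b <= b] yields [b * ~b <= ~b]; the square law and [~b <= b] settle the
    remaining products. *)
Lemma two_subreduct_hom (b : reduct A) : b * b = b -> ~` b <= b ->
  is_hom (fun i : reduct two => if i is true then b else ~` b).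
Proof.
move=> bb nb; have lA := ra_lattice rA.
have bn : b * ~` b = ~` b.
  apply: (ra_le_anti rA).
    by apply: (proj1 (ra_residuation rA _ _ _)); rewrite bb; apply: ra_le_refl.
  apply: ra_le_trans (ra_square rA _) _ => //.
  exact: ra_mul_mono nb (ra_le_refl rA _).
have nn : ~` b * ~` b = ~` b.
  apply: (ra_le_anti rA); last exact: ra_square.
  by rewrite -[X in _ <= X]bn; apply: ra_mul_mono nb (ra_le_refl rA _).
have joinI x : x `|` x = x :> reduct A.
  exact/(lattice_le_join lA)/(ra_le_refl rA).
have jn : ~` b `|` b = b by apply: lattice_le_join.
case=> t; rewrite [op t]/=;
  [| | |by rewrite (tuple1_eta (map_tuple _ t)) tnth_map;
        case: (tnth t ord0 : bool) => //; apply: esym (ra_negK rA b)];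
  rewrite (tuple2_eta (map_tuple _ t)) !tnth_map;
  case: (tnth t ord0 : bool) (tnth t ord_max : bool) => [] [].
- exact: esym bb.
- exact: esym bn.
- exact: etrans (esym bn) (ra_mulC rA _ _).
- exact: esym nn.
- exact: esym (ra_le_refl rA b).
- exact: etrans (esym nb) (lat_meetC lA _ _).
- exact: esym nb.
- exact: esym (ra_le_refl rA (~` b)).
- exact: esym (joinI b).
- exact: etrans (esym jn) (lat_joinC lA _ _).
- exact: esym jn.
- exact: esym (joinI (~` b)).
Qed.

Lemma two_variety (V : set (algebra ra_signature)) (x : reduct A) :
  is_variety V -> x <> unit_alg A -> V (reduct A) -> V (reduct two).
Proof.
move=> vV xe VA.
set e := unit_alg A in xe.
(* This choice puts both [e] and [x] between [~c] and [c], hence between [~b] and [b] for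
   [b = c * c]. Thus [~b = b] would force [x = e]. *)
pose c := (e `|` x) `|` ~` (e `&` x).
have ec : e <= c.
  apply: (ra_le_trans rA (y := e `|` x)); exact: ra_le_joinl.
have xc : x <= c.
  apply: (ra_le_trans rA (y := e `|` x));
    [exact: ra_le_joinr|exact: ra_le_joinl].
have nc : ~` c <= e `&` x.
  by rewrite -[X in _ <= X](ra_negK rA); apply/(ra_le_neg rA)/ra_le_joinr.
have nce : ~` c <= e by apply: (ra_le_trans rA) nc _; apply: ra_meet_lel.
have ncx : ~` c <= x by apply: (ra_le_trans rA) nc _; apply: ra_meet_ler.
have cb : c <= c * c by apply: ra_square.
have ncb := ra_le_neg rA cb.
have eb := ra_le_trans rA ec cb; have xb := ra_le_trans rA xc cb.
have nbe := ra_le_trans rA ncb nce; have nbx := ra_le_trans rA ncb ncx.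
have nbb : ~` (c * c) <> c * c.
  move=> bE; move: nbe nbx; rewrite bE => be bx; apply: xe.
  by apply: (ra_le_anti rA);
    [apply: (ra_le_trans rA) xb be|apply: (ra_le_trans rA) eb bx].
have nb_le_b := ra_le_trans rA nbe eb.
apply: (variety_S vV (two_subreduct_hom (mul_square ec nce) nb_le_b)) VA.
by move=> [] [] // /esym/nbb.
Qed.

End TwoSubreduct.

(** By directedness [x] and [y] lie in one local monoid, and at least one of them differs from its
    unit. *)
Lemma reduct_two_sub (V : set (algebra ra_signature))
    (A : algebra ra_signature) (x y : A) :
  is_variety V -> is_relevant_algebra A -> V A -> x <> y -> V (reduct two).
Proof.
move=> vV rA VA xy.
have [u [xu yu]] := preserved_directed rA x y.
pose z a (ua : preserved (local_unit u) a) : reduct (local_monoid rA u) :=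
  exist _ a ua.
have ux := xu _ (preserved_local_unit rA x).
have uy := yu _ (preserved_local_unit rA y).
have VD : V (reduct (local_monoid rA u)) by apply: local_algebra_variety.
have [xE|xE] := pselect (z x ux = unit_alg _); last first.
  exact: (two_variety (local_monoid_dmm rA u) vV xE VD).
apply: (two_variety (local_monoid_dmm rA u) vV (x := z y uy)) => //.
by rewrite -xE => /(congr1 sval) /esym.
Qed.

(** * Pulling varieties back along the reduct *)

Lemma reduct_preimage_variety (V : set (algebra ra_signature)) :
  is_variety V -> is_variety [set A | V (reduct A)].
Proof.
move=> vV; split.
- by move=> A B h /hom_reduct hh; apply: (variety_H vV hh).
- by move=> A B h /hom_reduct hh; apply: (variety_S vV hh).
- move=> I F VF.
  (* The two products differ only in their proofs of inhabitation. *)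
  apply: (@variety_S _ _ vV (reduct (prod_algebra F))
            (prod_algebra (fun i => reduct (F i))) id) => //.
    move=> f t; apply: functional_extensionality_dep => i.
    by congr op; apply: eq_from_tnth => m; rewrite !tnth_map.
  exact: (variety_P vV).
Qed.

Section Preimage.
Variable L : subvariety RA.

Lemma preimage_sub :
  [set A | subvariety_class L (reduct A)] `&` is_de_morgan_monoid `<=` DMM.
Proof. by move=> A []. Qed.

(** The largest subvariety whose reducts lie in [L], so the right adjoint of [reduct_variety]. *)
Definition reduct_preimage : subvariety DMM :=
  Subvariety (setI_is_variety (reduct_preimage_variety (subvarietyP L))
                dmm_is_variety) preimage_sub.

Lemma reduct_preimageK : reduct_variety reduct_preimage = L.
Proof.
apply: subvariety_inj; apply/seteqP; split.
  by apply: smallest_sub (subvarietyP L) _ => _ [A [LA _] <-].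
move=> A LA; have rA : is_relevant_algebra A := subvariety_sub LA.
apply: (directed_union_variety (generated_is_variety _)
  (subU := local_unit_sub rA) (preserved_directed rA)) => d.
  by exists d; apply: preserved_local_unit.
apply: sub_gen_smallest; exists (local_monoid rA d) => //.
split; last exact: local_monoid_dmm.
exact: local_algebra_variety (subvarietyP L) LA.
Qed.

End Preimage.

(** * The map between the subvariety lattices *)

Lemma reduct_variety_homo : {homo reduct_variety : K L / (K <= L)%O}.
Proof.
move=> K L /asboolP KL; apply/asboolP.
apply: smallest_sub; first exact: generated_is_variety.
by move=> _ [A KA <-]; apply: sub_gen_smallest; exists A => //; apply: KL.
Qed.

(** Joins are preserved because of the adjunction: [K] and [L] both lie in the preimage [W] of the
    join of their images, hence so does their join. *)
Lemma reduct_variety_join :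
  {morph reduct_variety : K L / (K `|` L)%O >-> (K `|` L)%O}.
Proof.
move=> K L; apply/le_anti/andP; split; last first.
  by rewrite leUx !reduct_variety_homo ?leUl ?leUr.
apply/asboolP; apply: smallest_sub; first exact: subvarietyP.
move=> _ [A KLA <-].
pose W := reduct_preimage (reduct_variety K `|` reduct_variety L)%O.
suff /asboolP KLW : (K `|` L <= W)%O by have [] := KLW A KLA.
rewrite leUx; apply/andP; split; apply/asboolP => B KB;
  (split; last exact: subvariety_sub KB);
  apply: sub_gen_smallest; [left|right]; apply: sub_gen_smallest; by exists B.
Qed.

Theorem theorem7p7 :
  [/\ {morph reduct_variety : K L / (K `|` L)%O >-> (K `|` L)%O},
      {homo reduct_variety : K L / (K <= L)%O},
      forall L : subvariety RA,
        exists K : subvariety DMM, reduct_variety K = L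
    & forall L : subvariety RA,
        exists K : subvariety DMM,
          (subvariety_class K two \/ K = trivial_subvariety DMM)
          /\ reduct_variety K = L].
Proof.
split; [exact: reduct_variety_join|exact: reduct_variety_homo| |].
  by move=> L; exists (reduct_preimage L); apply: reduct_preimageK.
move=> L.
(* The preimage of a trivial [L] omits [two], so this case takes the trivial subvariety. *)
have [tL|] := pselect (subvariety_class L `<=` @trivial_class ra_signature).
  exists (trivial_subvariety DMM); split; first by right.
  apply: subvariety_inj; apply/seteqP; split.
    apply: smallest_sub (subvarietyP L) _ => _ [A tA <-].
    exact: (trivial_sub_variety (subvarietyP L)).
  by apply: subset_trans tL _; apply: trivial_sub_variety; apply: subvarietyP.
move=> ntL; exists (reduct_preimage L); split; last exact: reduct_preimageK.
left; split; last exact: two_dmm.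
(* If [L] omitted the reduct of [two], none of its algebras could have two distinct elements. *)
apply: contrapT => nL2; apply: ntL => A LA x y.
by apply: contrapT => /(reduct_two_sub (subvarietyP L) (subvariety_sub LA) LA).
Qed.
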